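(* Let $\mathcal{A}$ be a finite action set, let $r_{\mathrm{true}}:\mathcal{A}\to\mathbb{R}$ be the true reward, and let $\pi_{\mathrm{ref}}$ be a probability distribution on $\mathcal{A}$. Assume that there are at least two actions $a_1,a_2\in\mathcal{A}$ with $r_{\mathrm{true}}(a_1)\ne r_{\mathrm{true}}(a_2)$ and that $\pi_{\mathrm{ref}}(a)>0$ for all $a\in\mathcal{A}$. Let $\beta>0$, let $\pi$ be a probability distribution on $\mathcal{A}$, and define the implicit reward $r^\pi_{\mathrm{imp}}(a)=\beta\log\frac{\pi(a)}{\pi_{\mathrm{ref}}(a)}$. If $r^\pi_{\mathrm{imp}}$ is rank-preserving with respect to $r_{\mathrm{true}}$, then $$\mathbb{E}_{a\sim\pi}[r_{\mathrm{true}}(a)]>\mathbb{E}_{a\sim\pi_{\mathrm{ref}}}[r_{\mathrm{true}}(a)].$$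
   Context: A reward $r$ is rank-preserving with respect to a reward $r'$ if for all $(a_1,a_2)\in\mathcal{A}\times\mathcal{A}$, $r'(a_1)>r'(a_2)$ implies $r(a_1)>r(a_2)$. Convention: $\log 0=-\infty$. *)

(* Defs.v *)
From HB Require Import structures.
From mathcomp Require Import all_boot all_order all_algebra.
From mathcomp Require Import reals ereal exp.

Set Implicit Arguments.
Unset Strict Implicit.
Unset Printing Implicit Defensive.

Import Order.TTheory GRing.Theory Num.Theory.

Local Open Scope ring_scope.

(* Distributions on the finite set A are given by their mass functions. *)
Definition is_distribution (R : realType) (A : finType) (p : A -> R) : Prop :=
  (forall a : A, 0 <= p a) /\ \sum_(a : A) p a = 1.

Definition expectation (R : realType) (A : finType) (p f : A -> R) : R :=
  \sum_(a : A) p a * f a.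

(* Rewards take extended real values, so that a logarithm of 0 is allowed. *)
Definition rank_preserving (R : realType) (A : finType) (r r' : A -> \bar R)
    : Prop :=
  forall a1 a2 : A, (r' a2 < r' a1)%E -> (r a2 < r a1)%E.

(* [lne] satisfies lne 0 = -oo; as 0 < beta is assumed wherever this is used,
   the implicit reward is then -oo at the actions a with pi a = 0. *)
Definition implicit_reward (R : realType) (A : finType) (beta : R)
    (pi_ref pi : A -> R) (a : A) : \bar R :=
  (beta%:E * lne (pi a / pi_ref a)%:E)%E.

(* Main.v *)
(* Chebyshev's sum inequality: antisymmetrising over pairs of actions,
   2 (E_pi r - E_ref r) = \sum_(a, b) (pi a ref b - pi b ref a) (r a - r b),
   and rank preservation makes the two factors of each summand agree in sign,
   strictly so when r a <> r b. *)
Require Import Defs.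
From HB Require Import structures.
From mathcomp Require Import all_boot all_order all_algebra.
From mathcomp Require Import reals ereal exp.
From mathcomp Require Import ring.

Import Order.TTheory GRing.Theory Num.Theory.

Local Open Scope ring_scope.

(** Clearing the logarithm and the denominators gives the sign of the first factor in the double
    sum. *)
Lemma implicit_reward_lt_cross {R : realType} {A : finType} {beta : R}
    {q p : A -> R} {a b : A} :
  0 < beta -> (forall c, 0 < q c) -> (forall c, 0 <= p c) ->
  (implicit_reward beta q p b < implicit_reward beta q p a)%E ->
  p b * q a < p a * q b.
Proof.
move=> beta_gt0 q_gt0 p_ge0 lt_ba.
rewrite -ltr_pdivlMr // mulrAC -ltr_pdivrMr //.
(* By contraposition, weak monotonicity of [lne] on nonnegative arguments suffices, and zero masses
   of [p] need no separate case. *)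
rewrite ltNge; apply: contraTN lt_ba => le_ab; rewrite -leNgt.
apply: lee_wpmul2l; first by rewrite lee_fin ltW.
by rewrite lee_lne ?in_itv /= ?leey ?lee_fin ?divr_ge0 // ltW.
Qed.

Lemma expectation_sub_antisym (R : realType) (A : finType) (p q f : A -> R) :
  is_distribution p -> is_distribution q ->
  (expectation p f - expectation q f) *+ 2 =
    \sum_a \sum_b (p a * q b - p b * q a) * (f a - f b).
Proof.
move=> [_ p1] [_ q1].
have main : \sum_a \sum_b (p a * q b - p b * q a) * f a =
            expectation p f - expectation q f.
  rewrite -sumrB; apply: eq_bigr => a _.
  by rewrite -mulr_suml sumrB -mulr_sumr -mulr_suml q1 p1; ring.
(* The second copy of the difference, with [a] and [b] exchanged, supplies the terms in [- f b]. *)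
rewrite mulr2n -{1}main -main [X in _ + X]exchange_big -big_split /=.
apply: eq_bigr => a _; rewrite -big_split /=; apply: eq_bigr => b _; ring.
Qed.

Theorem mainTheorem5 (R : realType) (A : finType) (r_true : A -> R)
    (pi_ref : A -> R) (pi_ref_distr : is_distribution pi_ref)
    (r_true_nonconst : exists a1 a2 : A, r_true a1 <> r_true a2)
    (pi_ref_pos : forall a : A, 0 < pi_ref a)
    (beta : R) (beta_pos : 0 < beta)
    (pi : A -> R) (pi_distr : is_distribution pi)
    (rank_pres : rank_preserving (implicit_reward beta pi_ref pi)
                                 (fun a : A => (r_true a)%:E)) :
  expectation pi r_true > expectation pi_ref r_true.
Proof.
pose t a b := (pi a * pi_ref b - pi b * pi_ref a) * (r_true a - r_true b).
have cross a b : r_true b < r_true a -> pi b * pi_ref a < pi a * pi_ref b.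
  move=> lt_r; apply: (implicit_reward_lt_cross beta_pos pi_ref_pos pi_distr.1).
  by apply: rank_pres; rewrite lte_fin.
have t_gt0 a b : r_true a != r_true b -> 0 < t a b.
  rewrite neq_lt /t => /orP[] lt_r; have := cross _ _ lt_r => lt_c.
    by rewrite nmulr_rgt0 subr_lt0.
  by rewrite mulr_gt0 // subr_gt0.
(* Rank preservation says nothing about ties of [r_true], but there the second factor makes [t a b]
   vanish. *)
have t_ge0 a b : 0 <= t a b.
  by have [eq_r|/t_gt0/ltW//] := eqVneq (r_true a) (r_true b);
    rewrite /t eq_r subrr mulr0.
have [a1 [a2 /eqP neq_r]] := r_true_nonconst.
rewrite -subr_gt0 -(pmulrn_lgt0 _ (ltn0Sn 1)) expectation_sub_antisym //.
(* The summand at ([a1], [a2]) is strictly positive; the rest of its row and all other rows are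
   nonnegative. *)
rewrite (bigD1 a1) //= (bigD1 a2) //= -addrA ltr_pwDl ?t_gt0 //.
rewrite addr_ge0 ?sumr_ge0 // => a _; first exact: t_ge0.
by apply: sumr_ge0 => b _; exact: t_ge0.
Qed.
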